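(* Let $n\ge 1$, let $\Delta$ be an upward equilateral triangle of side length $n$ divided into $n^2$ unit triangles, and let $S$ be a spread-out set of upward grid-aligned triangles in $\Delta$ (with pairwise disjoint interiors and side lengths summing to $n$), with $S\neq\{\Delta\}$. If no two distinct triangles in $S$ intersect (not even at a single point), then the region $\Delta\setminus\bigcup_{s\in S}s$ can be tiled by rhombi in at least two different ways.
   Context: All triangles are equilateral and grid-aligned, i.e. their vertices are vertices of the unit triangular grid on $\Delta$; ''upward'' means having the same orientation as $\Delta$. The size of an upward triangle is its side length; the intersection of two upward triangles is either empty, a point (size $0$), or an upward triangle. The size of an empty or one-point intersection is $0$. A rhombus is the union of two unit grid triangles sharing an edge. Tiling a region means partitioning (up to boundaries) the unit triangles of the region into rhombi. The members of $S$ are called holes. A set $S$ of upward triangles in $\Delta$ with pairwise disjoint interiors and sizes summing to $n$ is spread-out if for every upward grid-aligned triangle $T\subseteq\Delta$, $\sum_{s\in S}\mathrm{size}(s\cap T)\le \mathrm{size}(T)$. *)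

(* Defs.v *)
From HB Require Import structures.
From mathcomp Require Import all_boot all_order all_algebra.
From mathcomp Require Import zify ring lra.

Set Implicit Arguments.
Unset Strict Implicit.
Unset Printing Implicit Defensive.

Import Order.TTheory GRing.Theory Num.Theory.

(* Affine coordinates: two sides of Delta are taken as coordinate axes and the
   unit edge as unit length, so Delta is {(u, v) | 0 <= u, 0 <= v, u + v <= n},
   its grid vertices are the points with natural coordinates, and the upward
   triangle of size k with corner (x, y) has vertices
   (x, y), (x + k, y), (x, y + k). *)

(* Upward grid-aligned triangles of positive size contained in Delta. *)
Record uptri (n : nat) := UpTri {
  uptri_val :> 'I_n.+1 * 'I_n.+1 * 'I_n.+1;
  _ : (0 < uptri_val.2) && (uptri_val.1.1 + uptri_val.1.2 + uptri_val.2 <= n)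
}.
HB.instance Definition _ n := [isSub for @uptri_val n].
HB.instance Definition _ n := [Countable of uptri n by <:].
HB.instance Definition _ n := [Finite of uptri n by <:].

Section UpwardTriangles.
Variable n : nat.
Implicit Types s t T : uptri n.

Definition xmin s : nat := s.1.1.
Definition ymin s : nat := s.1.2.
Definition side s : nat := s.2.
(* s is {(u, v) | xmin s <= u, ymin s <= v, u + v <= xymax s}. *)
Definition xymax s : nat := xmin s + ymin s + side s.

Definition in_tri s (p : nat * nat) : bool :=
  [&& xmin s <= p.1, ymin s <= p.2 & p.1 + p.2 <= xymax s].

(* The closed triangles s and t have no common point; for grid-aligned
   triangles it is enough to look at grid vertices (see [apart_plane]). *)
Definition apart s t : Prop := forall p : nat * nat, ~~ (in_tri s p && in_tri t p).

(* Size of the intersection of s and t; truncated subtraction gives 0 when the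
   intersection is empty (see [tri_cap_plane], [tri_cap_apart]). *)
Definition cap_size s t : nat :=
  minn (xymax s) (xymax t) - (maxn (xmin s) (xmin t) + maxn (ymin s) (ymin t)).

(* Disjoint interiors: the intersection is empty or a single point
   (see [interior_disjoint_plane]). *)
Definition interior_disjoint s t : Prop := cap_size s t = 0.

Definition spread_out (S : {set uptri n}) : Prop :=
  forall T : uptri n, \sum_(s in S) cap_size s T <= side T.

Fact whole_subproof (hn : 0 < n) :
  let d := (ord0, ord0, ord_max) : 'I_n.+1 * 'I_n.+1 * 'I_n.+1 in
  (0 < d.2) && (d.1.1 + d.1.2 + d.2 <= n).
Proof. by rewrite /= hn !add0n leqnn. Qed.

(* The triangle Delta itself. *)
Definition whole (hn : 0 < n) : uptri n := UpTri (whole_subproof hn).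

End UpwardTriangles.

(* Unit triangles of the grid: (true, x, y) is the upward one with corner
   (x, y), and (false, x, y) is the downward one completing it to a unit
   parallelogram, with vertices (x + 1, y), (x, y + 1), (x + 1, y + 1). *)
Record unit_tri (n : nat) := UnitTri {
  unit_tri_val :> bool * 'I_n * 'I_n;
  _ : unit_tri_val.1.2 + unit_tri_val.2 + (if unit_tri_val.1.1 then 1 else 2) <= n
}.
HB.instance Definition _ n := [isSub for @unit_tri_val n].
HB.instance Definition _ n := [Countable of unit_tri n by <:].
HB.instance Definition _ n := [Finite of unit_tri n by <:].

Section Tilings.
Variable n : nat.

Definition vertices (c : unit_tri n) : seq (nat * nat) :=
  let x : nat := c.1.2 in let y : nat := c.2 in
  if c.1.1 then [:: (x, y); (x.+1, y); (x, y.+1)]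
  else [:: (x.+1, y); (x, y.+1); (x.+1, y.+1)].

(* The union of two unit triangles is identified with the set of these two;
   two unit triangles share an edge iff they have exactly two common vertices. *)
Definition share_edge (c d : unit_tri n) : bool :=
  count (mem (vertices d)) (vertices c) == 2.

Definition is_rhombus (B : {set unit_tri n}) : bool :=
  [exists c, exists d, share_edge c d && (B == [set c; d])].

(* By convexity, a unit triangle is contained in s iff its vertices are. *)
Definition cells (s : uptri n) : {set unit_tri n} :=
  [set c | all (in_tri s) (vertices c)].

Definition region (S : {set uptri n}) : {set unit_tri n} :=
  ~: \bigcup_(s in S) cells s.

Definition is_tiling (A : {set unit_tri n}) (P : {set {set unit_tri n}}) : bool :=
  partition P A && [forall B in P, is_rhombus B].

Definition tilings (A : {set unit_tri n}) : {set {set {set unit_tri n}}} :=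
  [set P | is_tiling A P].

End Tilings.

(* The definitions on upward triangles agree with the geometric notions for
   the triangles seen as subsets of the plane over any real field. *)
Section Plane.
Local Open Scope ring_scope.
Variables (R : realFieldType) (n : nat).
Implicit Types (s t : uptri n) (p : R * R).

Definition closed_tri (x y k : nat) p : bool :=
  [&& x%:R <= p.1, y%:R <= p.2 & p.1 + p.2 <= (x + y + k)%N%:R].
Definition open_tri (x y k : nat) p : bool :=
  [&& x%:R < p.1, y%:R < p.2 & p.1 + p.2 < (x + y + k)%N%:R].
Definition in_plane s p := closed_tri (xmin s) (ymin s) (side s) p.
Definition in_interior s p := open_tri (xmin s) (ymin s) (side s) p.

Let natr_max (a b : nat) : (maxn a b)%:R = Num.max a%:R b%:R :> R.
Proof.
case: (leqP a b) => h.
  by rewrite max_r // ler_nat.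
by rewrite max_l // ler_nat ltnW.
Qed.

Let natr_min (a b : nat) : (minn a b)%:R = Num.min a%:R b%:R :> R.
Proof.
case: (leqP a b) => h.
  by rewrite min_l // ler_nat.
by rewrite min_r // ler_nat ltnW.
Qed.

Let cap_aux s t p :
  in_plane s p && in_plane t p =
  [&& (maxn (xmin s) (xmin t))%:R <= p.1, (maxn (ymin s) (ymin t))%:R <= p.2
    & p.1 + p.2 <= (minn (xymax s) (xymax t))%:R].
Proof.
rewrite natr_max natr_min natr_max !ge_max le_min /in_plane /closed_tri /xymax.
by do 6!case: (_ <= _).
Qed.

Let cap_aux_open s t p :
  in_interior s p && in_interior t p =
  [&& (maxn (xmin s) (xmin t))%:R < p.1, (maxn (ymin s) (ymin t))%:R < p.2
    & p.1 + p.2 < (minn (xymax s) (xymax t))%:R].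
Proof.
rewrite natr_max natr_min natr_max !gt_max lt_min /in_interior /open_tri /xymax.
by do 6!case: (_ < _).
Qed.

Lemma apart_plane s t :
  apart s t <-> (forall p, ~~ (in_plane s p && in_plane t p)).
Proof.
split=> [h p|h [a b]].
  rewrite cap_aux; apply/negP => /and3P[h1 h2 h3].
  have := h (maxn (xmin s) (xmin t), maxn (ymin s) (ymin t)).
  have : (maxn (xmin s) (xmin t) + maxn (ymin s) (ymin t)
           <= minn (xymax s) (xymax t))%N.
    by rewrite -(ler_nat R) natrD; apply: le_trans h3; apply: lerD.
  by rewrite /in_tri /=; lia.
by have := h (a%:R, b%:R); rewrite /in_plane /closed_tri /= -natrD !ler_nat.
Qed.

Lemma tri_cap_plane s t p : ~ apart s t ->
  in_plane s p && in_plane t p =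
  closed_tri (maxn (xmin s) (xmin t)) (maxn (ymin s) (ymin t)) (cap_size s t) p.
Proof.
move=> h; rewrite cap_aux /closed_tri /cap_size subnKC // leqNgt.
apply/negP => lt; apply: h => -[a b]; apply/negP.
by rewrite /in_tri /=; lia.
Qed.

Lemma tri_cap_apart s t : apart s t -> cap_size s t = 0%N.
Proof.
move=> /(_ (maxn (xmin s) (xmin t), maxn (ymin s) (ymin t))).
by rewrite /in_tri /cap_size /=; lia.
Qed.

Lemma interior_disjoint_plane s t :
  interior_disjoint s t <-> (forall p, ~~ (in_interior s p && in_interior t p)).
Proof.
rewrite /interior_disjoint /cap_size.
set a := maxn _ _; set b := maxn _ _; set c := minn _ _.
split=> [/eqP h p|h].
  rewrite cap_aux_open -/a -/b -/c; apply/negP => /and3P[h1 h2 h3].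
  suff: (a + b < c)%N by move: h; lia.
  by rewrite -(ltr_nat R) natrD; apply: lt_trans h3; apply: ltrD.
apply/eqP; rewrite subn_eq0 leqNgt; apply/negP; rewrite -(ltr_nat R) natrD => lt.
pose d : R := (c%:R - (a%:R + b%:R)) / 3%:R.
have := h (a%:R + d, b%:R + d); rewrite cap_aux_open -/a -/b -/c /=.
by case/negP; apply/and3P; split; rewrite /d; lra.
Qed.

End Plane.

(* Main.v *)
(** Rhombi pair a downward unit triangle with an adjacent upward one, so tilings
    are perfect matchings of a bipartite graph, balanced because the sides of the
    holes sum to n.

    Existence is Hall's theorem.  Any set A of upward unit triangles is covered
    by triangles whose sides sum to at most |A| minus the number of downward
    unit triangles having all three neighbours in A: add the elements of A row
    by row; a new one completes at most one downward triangle, and then two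
    touching triangles are replaced by their hull.  If A contains all holes,
    spread-outness makes the sum of the sides at least n, which is Hall's
    condition.

    Two neighbours of a downward triangle always share a vertex, so, the holes
    being apart, at most one neighbour lies in a hole and every vertex on the
    downward side has degree at least two.  Such a matching admits an
    alternating cycle, hence a second matching. *)
Require Import Defs.
From mathcomp Require Import all_boot all_order all_algebra.
From mathcomp Require Import zify.

Set Implicit Arguments.
Unset Strict Implicit.
Unset Printing Implicit Defensive.

(** * Matchings saturating a set: Hall's theorem and second matchings *)

Section Matchings.
Variables I J : finType.
Implicit Types (r : I -> J -> bool) (D X : {set I}) (f : I -> J).

Definition nbhd r X : {set J} := [set j | [exists i in X, r i j]].

Lemma nbhdP r X j : reflect (exists2 i, i \in X & r i j) (j \in nbhd r X).
Proof. by rewrite inE; apply: (iffP exists_inP). Qed.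

Definition matching r D f :=
  {in D &, injective f} /\ {in D, forall i, r i (f i)}.

Lemma nbhdU r X Y : nbhd r (X :|: Y) = nbhd r X :|: nbhd r Y.
Proof.
apply/setP=> j; rewrite in_setU; apply/nbhdP/orP.
  by case=> i /setUP[] iX rij; [left|right]; apply/nbhdP; exists i.
by case=> /nbhdP[i iX rij]; exists i; rewrite // inE iX ?orbT.
Qed.

(** Values of [f2] avoid [K], so they cannot collide with those of [f1]. *)
Lemma matching_glue r D X (K : {set J}) f1 f2 :
  matching r X f1 -> {in X, forall i, f1 i \in K} ->
  matching (fun i j => r i j && (j \notin K)) (D :\: X) f2 ->
  matching r D (fun i => if i \in X then f1 i else f2 i).
Proof.
move=> [inj1 m1] K1 [inj2 m2].
have dX i : i \in D -> i \notin X -> i \in D :\: X by rewrite inE => -> ->.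
split=> [i i' iD i'D|i iD]; last first.
  by case: ifPn => [/m1//|iX]; case/andP: (m2 _ (dX _ iD iX)).
case: ifPn => iX; case: ifPn => i'X; first exact: inj1.
- by move=> e; case/andP: (m2 _ (dX _ i'D i'X)); rewrite -e K1.
- by move=> e; case/andP: (m2 _ (dX _ iD iX)); rewrite e K1.
- by apply: inj2; apply: dX.
Qed.

(** Induction on [#|D|]. If a nonempty proper [X] attains Hall's bound, [X] and its complement are
    matched separately; otherwise each such set has a spare neighbour, and the endpoints of any edge
    can be removed. [j0] gives a value when [D] is empty. *)
Theorem hall r D (j0 : J) :
  (forall X, X \subset D -> #|X| <= #|nbhd r X|) -> exists f, matching r D f.
Proof.
have [m] := ubnP #|D|; elim: m => // m IHm in r D *; rewrite ltnS => leDm hD.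
have [->|[d dD]] := set_0Vmem D.
  by exists (fun=> j0); split=> ?; rewrite ?inE.
have nbhdN (K : {set J}) Y : nbhd (fun i j => r i j && (j \notin K)) Y = nbhd r Y :\: K.
  apply/setP=> j; rewrite in_setD; apply/nbhdP/andP.
    by case=> i iY /andP[rij jK]; split=> //; apply/nbhdP; exists i.
  by case=> jK /nbhdP[i iY rij]; exists i; rewrite // rij.
have [X /and4P[sXD XD X0 critX]|noX] :=
    pickP (fun X => [&& X \subset D, X != D, X != set0 & #|nbhd r X| <= #|X|]).
  have ltX : #|X| < #|D| by apply: proper_card; rewrite properEneq XD.
  have [f1 m1] : exists f, matching r X f.
    apply: IHm => [|Y sYX]; first exact: leq_trans ltX leDm.
    by apply: hD; apply: subset_trans sXD.
  have [f2 m2] : exists f,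
      matching (fun i j => r i j && (j \notin nbhd r X)) (D :\: X) f.
    apply: IHm => [|Y sYD].
      by rewrite cardsDS //; move: X0 ltX leDm; rewrite -card_gt0; lia.
    have sYD' : Y \subset D by apply: subset_trans sYD (subsetDl _ _).
    have XY0 : X :&: Y = set0.
      apply/eqP; rewrite setIC setI_eq0.
      by move: sYD; rewrite subsetD => /andP[].
    (* Outside [nbhd r X] there remain at least [#|X :|: Y| - #|nbhd r X|] neighbours of [Y], which
       is at least [#|Y|]. *)
    have := hD (X :|: Y); rewrite subUset sXD sYD' => /(_ isT).
    rewrite nbhdN nbhdU !cardsU XY0 cards0 cardsD (setIC (nbhd r Y)).
    have := subset_leq_card (subsetIr (nbhd r X) (nbhd r Y)).
    by move: critX; lia.
  exists (fun i => if i \in X then f1 i else f2 i).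
  apply: (matching_glue m1 _ m2) => i iX; apply/nbhdP; exists i => //.
  exact: (proj2 m1).
have [j /nbhdP[_ /set1P-> rdj]] : exists j, j \in nbhd r [set d].
  apply/set0Pn; rewrite -card_gt0; apply: leq_trans (hD _ _).
    by rewrite cards1.
  by rewrite sub1set.
have [f2 m2] : exists f,
    matching (fun i j' => r i j' && (j' \notin [set j])) (D :\: [set d]) f.
  apply: IHm => [|Y sYD].
    by apply: leq_trans leDm; rewrite [X in _ < X](cardsD1 d) dD.
  have [->|Y0] := eqVneq Y set0; first by rewrite cards0.
  have sYD' : Y \subset D by apply: subset_trans sYD (subsetDl _ _).
  have YD : Y != D.
    by apply: contraTneq sYD => ->; apply/subsetPn; exists d; rewrite ?inE ?eqxx.
  have := noX Y; rewrite sYD' YD Y0 /= => /negbT; rewrite -ltnNge.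
  rewrite nbhdN cardsD.
  have := subset_leq_card (subsetIr (nbhd r Y) [set j]).
  by rewrite cards1; lia.
exists (fun i => if i \in [set d] then j else f2 i).
apply: (matching_glue (f1 := fun=> j)) m2 => [|i _]; last exact: set11.
by split=> [i i' /set1P-> /set1P-> //|i /set1P->].
Qed.

(* Sending i to the partner of another neighbour of i is a self-map of D; it
   permutes a minimal stable nonempty set C, along which f can be shifted. *)
Theorem second_matching r D (E : {set J}) f :
  D != set0 -> #|E| <= #|D| -> matching r D f ->
  (forall i j, r i j -> j \in E) ->
  {in D, forall i, exists2 j, r i j & j != f i} ->
  exists2 g, matching r D g & exists2 i, i \in D & g i != f i.
Proof.
move=> D0 leED [injf mf] rE alt.
(* Counting makes [f] onto [E], so every alternative neighbour has a partner. *)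
have fDE : f @: D = E.
  apply/eqP; rewrite eqEcard card_in_imset // leED andbT.
  by apply/subsetP=> _ /imsetP[i iD ->]; apply: rE (mf i iD).
pose other i i' := [&& i' \in D, r i (f i') & i' != i].
pose step i := odflt i [pick i' | other i i'].
have stepP i : i \in D -> other i (step i).
  move=> iD; rewrite /step; case: pickP => //= no.
  have [j rij ji] := alt i iD; move: (rE _ _ rij); rewrite -fDE.
  case/imsetP=> i' i'D e; move: (no i').
  by rewrite /other i'D -e rij; case: eqP => // ei; rewrite e ei eqxx in ji.
pose stable C := [&& C != set0, C \subset D & step @: C \subset C].
have stD : stable D.
  rewrite /stable D0 subxx; apply/subsetP=> _ /imsetP[i iD ->].
  by case/and3P: (stepP i iD).
have [C /minsetP[/and3P[C0 sCD sC] minC] _] := minset_exists stD.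
(* The image of [C] is again stable, so minimality gives equality, and finiteness then gives
   injectivity. *)
have stepC : step @: C = C.
  apply: minC => //; rewrite /stable (subset_trans sC sCD) (imsetS _ sC) !andbT.
  by have /set0Pn[i iC] := C0; apply/set0Pn; exists (step i); apply: imset_f.
have injC : {in C &, injective step} by apply/imset_injP; rewrite stepC.
have stepD i : i \in C -> step i \in D.
  by move=> /(subsetP sCD)/stepP/and3P[].
exists (fun i => if i \in C then f (step i) else f i); last first.
  have /set0Pn[i iC] := C0; have iD := subsetP sCD _ iC.
  exists i => //; rewrite iC; apply/eqP => /(injf _ _ (stepD _ iC) iD) e.
  by case/and3P: (stepP i iD); rewrite e eqxx.
(* Shifted values stay in [f @: C], which [f] avoids on [D :\: C] by injectivity. *)
apply: (@matching_glue _ _ _ (f @: C) (f \o step) f) => [|i iC|].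
- split=> [i i' iC i'C /= /injf e|i /(subsetP sCD)/stepP/and3P[] //].
  by apply: injC => //; apply: e; apply: stepD.
- by apply: imset_f; rewrite -stepC imset_f.
- split=> [i i' /setDP[iD _] /setDP[i'D _]|i /setDP[iD iC]]; first exact: injf.
  rewrite mf //=; apply/imsetP=> -[i' i'C /injf e].
  by rewrite (e iD (subsetP sCD _ i'C)) i'C in iC.
Qed.

End Matchings.

(** * Cardinals of disjoint unions and of sets inside an interval *)

Lemma card_bigcup_disjoint (T I : finType) (S : {set I}) (F : I -> {set T}) :
  {in S &, forall i j, i != j -> [disjoint F i & F j]} ->
  #|\bigcup_(i in S) F i| = \sum_(i in S) #|F i|.
Proof.
move=> disjF; rewrite big_mkcond -sum1_card partition_disjoint_bigcup.
  rewrite [RHS]big_mkcond; apply: eq_bigr => i _; rewrite sum1_card.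
  by case: ifP; rewrite ?cards0.
move=> i j ij; case: ifP => iS; last by rewrite -setI_eq0 set0I.
by case: ifP => jS; [apply: disjF|rewrite -setI_eq0 setI0].
Qed.

Lemma card_window k lo m (P : {set 'I_k}) :
  (forall i : 'I_k, i \in P -> lo <= i < lo + m) -> #|P| <= m.
Proof.
move=> winP; rewrite cardE -(size_map val) -(size_iota lo m).
apply: uniq_leq_size => [|_ /mapP[i iP ->]].
  by rewrite map_inj_uniq ?enum_uniq //; apply: val_inj.
by rewrite mem_iota; apply: winP; rewrite -mem_enum.
Qed.

(** * Coordinates, adjacency and containment of unit triangles *)

Section UnitTriangles.
Variable n : nat.
Implicit Types (c d u v : unit_tri n) (s T : uptri n) (A : {set unit_tri n}).

Definition isup c : bool := c.1.1.
Definition cx c : nat := c.1.2.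
Definition cy c : nat := c.2.

Lemma unit_triP c : cx c + cy c + (if isup c then 1 else 2) <= n.
Proof. exact: (valP c). Qed.

Lemma unit_tri_eq c d : isup c = isup d -> cx c = cx d -> cy c = cy d -> c = d.
Proof.
case: c d => [[[b x] y] p] [[[b' x'] y'] p']; rewrite /isup /cx /cy /=.
by move=> eb ex ey; apply: val_inj => /=; rewrite eb (val_inj ex) (val_inj ey).
Qed.

Lemma unit_tri_ex b x y : x + y + (if b then 1 else 2) <= n ->
  exists c, [/\ isup c = b, cx c = x & cy c = y].
Proof.
move=> le; have hx : x < n by case: b le; lia.
have hy : y < n by case: b le {hx}; lia.
by exists (@UnitTri n (b, Ordinal hx, Ordinal hy) le).
Qed.

Lemma uptriP s : 0 < side s /\ xymax s <= n.
Proof. by apply/andP; apply: (valP s). Qed.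

Lemma uptri_ex a b k : 0 < k -> a + b + k <= n ->
  exists s, [/\ xmin s = a, ymin s = b & side s = k].
Proof.
move=> k0 le.
have [ha hb hk] : [/\ a < n.+1, b < n.+1 & k < n.+1] by split; lia.
have p : (0 < k) && (a + b + k <= n) by rewrite k0.
by exists (@UpTri n (Ordinal ha, Ordinal hb, Ordinal hk) p).
Qed.

Lemma uptri_eq s T :
  xmin s = xmin T -> ymin s = ymin T -> side s = side T -> s = T.
Proof.
case: s T => [[[x y] k] p] [[[x' y'] k'] p']; rewrite /xmin /ymin /side /=.
move=> ex ey ek; apply: val_inj => /=.
by rewrite (val_inj ex) (val_inj ey) (val_inj ek).
Qed.

(** Over the vertices of [c] the least coordinates are [cx c] and [cy c]; the largest coordinate sum
    exceeds [cx c + cy c] by 1 or 2, according to orientation. *)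
Lemma mem_cells s c : (c \in cells s) =
  [&& xmin s <= cx c, ymin s <= cy c
    & cx c + cy c + (if isup c then 1 else 2) <= xymax s].
Proof.
rewrite inE /vertices /isup /cx /cy /in_tri.
by case: (c.1.1) => /=; apply/idP/idP; lia.
Qed.

(* The neighbours of the downward triangle (x, y) are the upward triangles
   (x, y), (x + 1, y) and (x, y + 1). *)
Definition adj d u := [&& ~~ isup d, isup u, cx d <= cx u, cy d <= cy u
  & cx u + cy u <= (cx d + cy d).+1].

Lemma adjP d u : adj d u -> [/\ isup d = false, isup u = true, cx d <= cx u,
  cy d <= cy u & cx u + cy u <= (cx d + cy d).+1].
Proof. by case/and5P=> /negbTE. Qed.

Lemma adj_share_edge d u : adj d u -> share_edge d u.
Proof.
case/adjP; rewrite /share_edge /vertices /isup /cx /cy => -> -> /=.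
move: (d.1.2 : nat) (d.2 : nat) (u.1.2 : nat) (u.2 : nat) => x y x' y'.
move=> hx hy hxy; rewrite !inE !xpair_eqE.
have : [|| (x' == x) && (y' == y), (x' == x.+1) && (y' == y) |
           (x' == x) && (y' == y.+1)] by lia.
by case/or3P=> /andP[/eqP-> /eqP->];
  rewrite !eqxx ?eqn_leq ?ltnn ?leqnSn ?andbT ?andbF ?orbT.
Qed.

(** All three neighbours lie in the grid, since a downward triangle already forces
    [cx d + cy d + 2 <= n]. *)
Lemma adj_ex d i j : ~~ isup d -> i + j <= 1 ->
  exists u, [/\ adj d u, cx u = cx d + i & cy u = cy d + j].
Proof.
move=> dd ij.
have [|u [uu ux uy]] := @unit_tri_ex true (cx d + i) (cy d + j).
  by have := unit_triP d; rewrite (negbTE dd); lia.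
by exists u; split=> //; rewrite /adj dd uu ux uy; lia.
Qed.

Lemma adj_cells s d u : adj d u -> d \in cells s -> u \in cells s.
Proof. by case/adjP=> dd uu ? ? ?; rewrite !mem_cells dd uu; lia. Qed.

(** Two distinct neighbours attain between them both least coordinates of [d] and the corner sum
    [cx d + cy d + 1], so they impose all three bounds for [d]. *)
Lemma adj2_cells s d u v : adj d u -> adj d v -> u != v ->
  u \in cells s -> v \in cells s -> d \in cells s.
Proof.
move=> /adjP[dd uu ? ? ?] /adjP[_ vv ? ? ?] uv.
have : (cx u != cx v) || (cy u != cy v).
  rewrite -negb_and; apply: contra uv => /andP[/eqP ? /eqP ?].
  by apply/eqP/unit_tri_eq; rewrite ?uu ?vv.
by rewrite !mem_cells dd uu vv; lia.
Qed.

(** The coordinatewise maximum of the corners of [u] and [v] is a vertex of both. *)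
Lemma adj2_touch s T d u v : adj d u -> adj d v ->
  u \in cells s -> v \in cells T -> ~ apart s T.
Proof.
move=> /adjP[dd uu ? ? ?] /adjP[_ vv ? ? ?]; rewrite !mem_cells uu vv.
move=> hu hv /(_ (maxn (cx u) (cx v), maxn (cy u) (cy v))).
by rewrite /in_tri /=; lia.
Qed.

Lemma apart_disjoint_cells s T : apart s T -> [disjoint cells s & cells T].
Proof.
move=> ap; rewrite -setI_eq0; apply/eqP/setP=> c; rewrite !inE.
apply/negbTE/negP => /andP[/allP hs /allP ht].
have [p pc] : exists p, p \in vertices c.
  by rewrite /vertices; case: ifP => _; eexists; apply: mem_head.
by have := ap p; rewrite hs ?ht.
Qed.

(** * Counting unit triangles by orientation *)

Definition ups A := [set c in A | isup c].
Definition downs A := [set c in A | ~~ isup c].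

Lemma card_ups_downs A : #|A| = #|ups A| + #|downs A|.
Proof.
rewrite -(cardsID [set c | isup c] A); congr addn; apply: eq_card => c.
  by rewrite !inE.
by rewrite !inE andbC.
Qed.

Lemma bottom_row s : exists h : 'I_(side s) -> unit_tri n, forall i,
  [/\ isup (h i), cx (h i) = xmin s + i & cy (h i) = ymin s].
Proof.
suff /fin_all_exists[h hP] (i : 'I_(side s)) : exists c,
    [/\ isup c, cx c = xmin s + i & cy c = ymin s] by exists h.
apply: (@unit_tri_ex true).
by have := uptriP s; have := ltn_ord i; rewrite /xymax; lia.
Qed.

(* Every upward triangle of s outside the bottom row lies on top of a downward
   one. *)
Lemma card_cells s : #|ups (cells s)| = #|downs (cells s)| + side s.
Proof.
have [h hP] := bottom_row s.
(* [g] moves a downward triangle to the upward one above it; its values on upward triangles are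
   arbitrary. *)
have [g gP] : exists g : unit_tri n -> unit_tri n, forall d, ~~ isup d ->
    [/\ isup (g d), cx (g d) = cx d & cy (g d) = (cy d).+1].
  suff /fin_all_exists[g gP] (d : unit_tri n) : exists u, ~~ isup d ->
      [/\ isup u, cx u = cx d & cy u = (cy d).+1] by exists g.
  have [ud|dd] := boolP (isup d); first by exists d.
  have [//|//|u [/adjP[_ uu _ _ _] ux uy]] := @adj_ex d 0 1.
  by exists u; rewrite uu ux uy addn0 addn1.
have -> : ups (cells s) = (g @: downs (cells s)) :|: (h @: 'I_(side s)).
  apply/setP=> u; rewrite in_setU; apply/idP/orP.
    rewrite inE mem_cells => /andP[us uu]; rewrite uu in us.
    have [b|nb] := eqVneq (cy u) (ymin s).
      right; have hi : cx u - xmin s < side s by move: us; rewrite /xymax; lia.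
      apply/imsetP; exists (Ordinal hi) => //.
      have [h1 h2 h3] := hP (Ordinal hi).
      by apply: unit_tri_eq; rewrite ?h1 ?h2 ?h3 //=; lia.
    left; have [|d [dd dx dy]] := @unit_tri_ex false (cx u) (cy u).-1.
      by have := unit_triP u; rewrite uu; lia.
    apply/imsetP; exists d; first by rewrite inE mem_cells dd dx dy; lia.
    have [|g1 g2 g3] := gP d; first by rewrite dd.
    by apply: unit_tri_eq; rewrite ?g1 ?g2 ?g3 ?dx ?dy //; lia.
  case=> [/imsetP[d]|/imsetP[i _ ->]].
    rewrite inE => /andP[ds dd] ->; have [g1 g2 g3] := gP d dd.
    rewrite inE mem_cells g1 g2 g3; move: ds.
    by rewrite mem_cells (negbTE dd); lia.
  have [h1 h2 h3] := hP i; rewrite inE mem_cells h1 h2 h3.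
  by have := ltn_ord i; rewrite /xymax; lia.
rewrite cardsU card_in_imset; last first.
  move=> d d' /setIdP[_ dd] /setIdP[_ dd'] e.
  have [_ x y] := gP d dd; have [_ x' y'] := gP d' dd'; rewrite e in x y.
  by apply: unit_tri_eq; rewrite ?(negbTE dd) ?(negbTE dd') //; lia.
rewrite card_imset => [|i i' e]; last first.
  have [_ x _] := hP i; have [_ x' _] := hP i'; rewrite e in x.
  by apply: val_inj => /=; lia.
rewrite card_ord (_ : _ :&: _ = set0) ?cards0 ?subn0 //.
apply/setP=> u; rewrite in_setI in_set0; apply/negbTE/negP => /andP[].
case/imsetP=> d /setIdP[ds dd] -> /imsetP[i _ e].
have [_ _ y] := gP d dd; have [_ _ y'] := hP i; rewrite e in y.
by move: ds; rewrite mem_cells; lia.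
Qed.

(** * Covering upward unit triangles by larger triangles *)

Definition covers (Ts : seq (uptri n)) A :=
  forall u, u \in A -> exists2 T, T \in Ts & u \in cells T.

(** Each bottom-row cell of [s] lies in some member of [Ts], and the row cells lying in one [T] fit
    in a window of length [cap_size s T]. *)
Lemma side_le_cover s Ts :
  covers Ts (ups (cells s)) -> side s <= \sum_(T <- Ts) cap_size s T.
Proof.
move=> cov; have [h hP] := bottom_row s.
apply: (@leq_trans (\sum_(T <- Ts) #|[set i | h i \in cells T]|)); last first.
  apply: leq_sum => T _.
  apply: (@card_window _ (maxn (xmin s) (xmin T) - xmin s)) => i.
  rewrite inE mem_cells; have [-> -> ->] := hP i.
  by have := ltn_ord i; rewrite /cap_size /xymax; lia.
under eq_bigr do rewrite -sum1_card big_mkcond.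
rewrite exchange_big /= -[X in X <= _]card_ord -sum1_card; apply: leq_sum => i _.
have [|T TTs hT] := cov (h i).
  have [h1 h2 h3] := hP i; rewrite inE mem_cells h1 h2 h3.
  by have := ltn_ord i; rewrite /xymax; lia.
by rewrite (big_rem T) //= inE hT.
Qed.

Definition full A := [set d | ~~ isup d & [forall u, adj d u ==> (u \in A)]].

Lemma fullP A d :
  reflect (~~ isup d /\ forall u, adj d u -> u \in A) (d \in full A).
Proof.
rewrite inE; apply: (iffP andP) => -[dd dA]; split=> //.
  by move=> u; apply/implyP; move/forallP: dA.
by apply/forallP => u; apply/implyP/dA.
Qed.

(* Two triangles containing two neighbours of one downward triangle share a
   point, so the side of their hull is at most the sum of their sides. *)
Lemma hull_ex s T d u v : adj d u -> adj d v -> u \in cells s -> v \in cells T ->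
  exists H, [/\ cells s \subset cells H, cells T \subset cells H
              & side H <= side s + side T].
Proof.
move=> /adjP[dd uu ? ? ?] /adjP[_ vv ? ? ?]; rewrite !mem_cells uu vv => hu hv.
have [? ?] := uptriP s; have [? ?] := uptriP T.
pose a := minn (xmin s) (xmin T); pose b := minn (ymin s) (ymin T).
pose c := maxn (xymax s) (xymax T).
have abc : a + b < c by rewrite /a /b /c; lia.
have [||H [Ha Hb Hk]] := @uptri_ex a b (c - (a + b)).
- by rewrite subn_gt0.
- by rewrite /a /b /c in abc *; lia.
have Hc : xymax H = c by rewrite /xymax Ha Hb Hk; lia.
exists H; split.
- by apply/subsetP=> e; rewrite !mem_cells Ha Hb Hc /a /b /c; lia.
- by apply/subsetP=> e; rewrite !mem_cells Ha Hb Hc /a /b /c; lia.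
- by rewrite Hk; move: hu hv; rewrite /a /b /c /xymax; lia.
Qed.

(** Remove the last element [u] of [A] in row order. Putting it back raises [#|A|] by one, which
    pays for a new unit triangle in the cover or for one new full downward triangle, never both. *)
Lemma triangle_cover A : A \subset [set c | isup c] ->
  exists2 Ts, covers Ts A & \sum_(T <- Ts) side T + #|full A| <= #|A|.
Proof.
have [m] := ubnP #|A|; elim: m => // m IHm in A *; rewrite ltnS => leAm upA.
have [A0|[u0 u0A]] := set_0Vmem A.
  exists [::]; first by move=> u; rewrite A0 inE.
  rewrite big_nil add0n A0 cards0 leqn0 cards_eq0; apply/set0Pn => -[d].
  case/fullP => dd dA; have [//|//|u [/dA]] := @adj_ex d 0 0.
  by rewrite inE.
have [u uA umax] : exists2 u, u \in A &
    forall v, v \in A -> cy v < cy u \/ cy v = cy u /\ cx v <= cx u.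
  (* The weight [n] makes the order lexicographic, rows first, because [cx v < n]. *)
  case: (@arg_maxnP _ u0 (mem A) (fun v => cy v * n + cx v) u0A) => u uA umax.
  exists u => // v /umax /=; have := unit_triP u; have := unit_triP v.
  by case: (isup u) (isup v) => -[]; nia.
have uu : isup u by move/subsetP: upA => /(_ u uA); rewrite inE.
have cardA : #|A| = #|A :\ u|.+1 by rewrite (cardsD1 u) uA.
have [||Ts cov leTs] := IHm (A :\ u); first by rewrite -cardA.
  by apply: subset_trans upA; apply: subsetDl.
(* The right and upper neighbours of [d] lie in [A], so the last element [u] is the upper one; hence
   [u] determines [d]. *)
have last_d d : d \in full A -> adj d u -> cx d = cx u /\ (cy d).+1 = cy u.
  case/fullP => dd dA /adjP[_ _ ? ? ?].
  have [//|//|v [/dA/umax + ? ?]] := @adj_ex d 1 0.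
  have [//|//|w [/dA/umax + ? ?]] := @adj_ex d 0 1.
  by lia.
have [d /andP[dA du]|nod] := pickP (fun d => (d \in full A) && adj d u); last first.
  have [|U [Ux Uy Uk]] := @uptri_ex (cx u) (cy u) 1 isT.
    by have := unit_triP u; rewrite uu.
  exists (U :: Ts) => [v vA|].
    have [->|vu] := eqVneq v u.
      exists U; first exact: mem_head.
      by rewrite mem_cells uu /xymax Ux Uy Uk; lia.
    have [|T TTs vT] := cov v; first by rewrite !inE vu.
    by exists T; rewrite // inE TTs orbT.
  have : #|full A| <= #|full (A :\ u)|.
    apply: subset_leq_card; apply/subsetP=> d dA.
    have /fullP[dd dA'] := dA; apply/fullP; split=> // v dv.
    rewrite !inE dA' // andbT; apply: contraTneq dv => ->.
    by have := nod d; rewrite dA /= => ->.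
  by rewrite big_cons Uk; lia.
have /fullP[dd dA'] := dA; have [dx dy] := last_d d dA du.
have lefull : #|full A| <= #|full (A :\ u)|.+1.
  rewrite -add1n -(cards1 d); apply: leq_trans (leq_card_setU _ _).
  apply: subset_leq_card; apply/subsetP=> e eA; rewrite in_setU in_set1.
  have [//|ed] := eqVneq e d; have /fullP[de eA'] := eA.
  apply/fullP; split=> // v ev; rewrite !inE eA' // andbT.
  apply: contraNneq ed => vu; rewrite vu in ev.
  have [ex ey] := last_d e eA ev; apply/eqP/unit_tri_eq.
  - by rewrite (negbTE dd) (negbTE de).
  - by rewrite dx ex.
  - by apply: succn_inj; rewrite dy ey.
have lestep k : k + #|full (A :\ u)| <= #|A :\ u| -> k + #|full A| <= #|A|.
  move=> le; rewrite cardA.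
  by apply: (@leq_trans (k + #|full (A :\ u)|.+1)); rewrite ?leq_add2l ?addnS.
(* The other two neighbours of [d] are already covered; a triangle containing both contains [d],
   hence [u]. *)
have [//|//|v [dv vx vy]] := @adj_ex d 0 0.
have [//|//|w [dw wx wy]] := @adj_ex d 1 0.
have vu : v != u by apply/eqP => e; clear -e vy dy; rewrite e in vy; lia.
have wu : w != u by apply/eqP => e; clear -e wy dy; rewrite e in wy; lia.
have vw : v != w by apply/eqP => e; clear -e vx wx; rewrite e in vx; lia.
have [|T TTs vT] := cov v; first by rewrite !inE vu dA'.
have [|T' T'Ts wT'] := cov w; first by rewrite !inE wu dA'.
have inT H : v \in cells H -> w \in cells H -> u \in cells H.
  by move=> vH wH; apply: adj_cells du (adj2_cells dv dw vw vH wH).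
have [TT'|TT'] := eqVneq T T'.
  exists Ts => [z zA|]; last exact: lestep.
  have [->|zu] := eqVneq z u; last by apply: cov; rewrite !inE zu.
  by exists T => //; apply: inT; rewrite // TT'.
(* Two distinct covering triangles give way to their hull, which does not increase the total
   side. *)
have [H [/subsetP sTH /subsetP sT'H leH]] := hull_ex dv dw vT wT'.
have pTs : perm_eq Ts (T :: T' :: rem T' (rem T Ts)).
  apply: perm_trans (perm_to_rem TTs) _; rewrite perm_cons.
  apply: perm_to_rem.
  by move: T'Ts; rewrite (perm_mem (perm_to_rem TTs)) inE eq_sym (negbTE TT').
exists (H :: rem T' (rem T Ts)) => [z zA|]; last first.
  apply: lestep; apply: leq_trans leTs; rewrite (perm_big _ pTs) /= !big_cons.
  by rewrite leq_add2r addnA leq_add2r.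
have [->|zu] := eqVneq z u.
  by exists H; rewrite ?mem_head //; apply: inT; [apply: sTH|apply: sT'H].
have [|Z] := cov z; first by rewrite !inE zu.
rewrite (perm_mem pTs) !in_cons => /or3P[/eqP->|/eqP->|ZTs] zZ.
- by exists H; [apply: mem_head|apply: sTH].
- by exists H; [apply: mem_head|apply: sT'H].
- by exists Z; rewrite // inE ZTs orbT.
Qed.

(** * Matchings as rhombus tilings *)

Definition radj A d u := adj d u && (u \in A).
Definition rhombi A (f : unit_tri n -> unit_tri n) :=
  [set [set d; f d] | d in downs A].

(** Equal numbers make [f] onto the upward cells of [A], so all cells are covered; rhombi with a
    common cell coincide, by injectivity if that cell is upward. *)
Lemma matching_tiling A f : matching (radj A) (downs A) f ->
  #|ups A| = #|downs A| -> is_tiling A (rhombi A f).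
Proof.
move=> [injf mf] cardA.
have imf : f @: downs A = ups A.
  apply/eqP; rewrite eqEcard card_in_imset // cardA leqnn andbT.
  apply/subsetP=> _ /imsetP[d dA ->].
  case/andP: (mf d dA) => /adjP[_ ud _ _ _] fA.
  by rewrite inE fA ud.
have fA d : d \in downs A -> [/\ adj d (f d), f d \in A & isup (f d)].
  by move=> dA; case/andP: (mf d dA) => a fA; split=> //; case/adjP: a.
apply/andP; split; last first.
  apply/forall_inP => _ /imsetP[d dA ->]; have [a _ _] := fA d dA.
  by apply/existsP; exists d; apply/existsP; exists (f d); rewrite adj_share_edge /=.
apply/and3P; split.
- rewrite /cover eqEsubset; apply/andP; split; apply/subsetP=> c.
    case/bigcupP => _ /imsetP[d dA ->]; have [_ fdA _] := fA d dA.
    by case/set2P=> ->; last by []; case/setIdP: dA.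
  move=> cA; apply/bigcupP; have [uc|dc] := boolP (isup c).
    have : c \in f @: downs A by rewrite imf inE cA.
    case/imsetP=> d dA ->; exists [set d; f d]; last exact: set22.
    exact: imset_f.
  have dA : c \in downs A by rewrite inE cA.
  by exists [set c; f c]; [apply: imset_f|apply: set21].
- apply/trivIsetP => _ _ /imsetP[d dA ->] /imsetP[e eA ->].
  apply: contraR => /pred0Pn[c /andP[/= /set2P cd /set2P ce]].
  have [_ _ ufd] := fA d dA; have [_ _ ufe] := fA e eA.
  suff -> : d = e by [].
  case/setIdP: (dA) => _ dd; case/setIdP: (eA) => _ de.
  case: cd ce => -> [] // E.
  + by rewrite E ufe in dd.
  + by rewrite -E ufd in de.
  + exact: injf.
- apply/imsetP => -[d _ /setP/(_ d)].
  by rewrite in_set0 set21.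
Qed.

(** A rhombus has exactly one downward cell, and its other cell is the value of the matching
    there. *)
Lemma rhombi_inj A f g :
  matching (radj A) (downs A) f -> matching (radj A) (downs A) g ->
  rhombi A f = rhombi A g -> {in downs A, f =1 g}.
Proof.
move=> [_ mf] [_ mg] efg d dA; case/setIdP: (dA) => _ dd.
case/andP: (mf d dA) => /adjP[_ ufd _ _ _] _.
have : [set d; f d] \in rhombi A g by rewrite -efg; apply: imset_f.
case/imsetP=> e eA E; case/andP: (mg e eA) => /adjP[_ uge _ _ _] _.
have : d \in [set e; g e] by rewrite -E set21.
case/set2P => de; last by rewrite de uge in dd.
have : f d \in [set e; g e] by rewrite -E set22.
case/set2P => [fe|->]; last by rewrite de.
by rewrite fe -de (negbTE dd) in ufd.
Qed.

End UnitTriangles.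

(** * Balance, Hall's condition and degrees outside the holes *)

Section Holes.
Variables (n : nat) (hn : 0 < n) (S : {set uptri n}).
Hypothesis hsum : \sum_(s in S) side s = n.
Hypothesis hspread : spread_out S.
Hypothesis hapart :
  forall s t : uptri n, s \in S -> t \in S -> s != t -> apart s t.

Definition holes : {set unit_tri n} := \bigcup_(s in S) cells s.

Lemma mem_region c : (c \in region S) = (c \notin holes).
Proof. by rewrite inE. Qed.

Lemma card_holes : #|ups holes| = #|downs holes| + n.
Proof.
have bigI (P : pred (unit_tri n)) :
    #|[set c in holes | P c]| = \sum_(s in S) #|[set c in cells s | P c]|.
  rewrite -card_bigcup_disjoint => [|s t sS tS st].
    apply: eq_card => c; rewrite inE.
    apply/andP/bigcupP => [[/bigcupP[s sS cs] Pc]|[s sS /setIdP[cs Pc]]].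
      by exists s; rewrite // inE cs.
    by split=> //; apply/bigcupP; exists s.
  have := apart_disjoint_cells (hapart sS tS st).
  apply: disjointW; apply/subsetP=> c /setIdP[] //.
rewrite -[X in _ + X]hsum !bigI -big_split /=.
by apply: eq_bigr => s _; apply: card_cells.
Qed.

Lemma card_grid : #|ups [set: unit_tri n]| = #|downs [set: unit_tri n]| + n.
Proof.
suff <- : cells (whole hn) = setT by rewrite card_cells.
apply/setP=> c; rewrite mem_cells inE; have := unit_triP c.
by rewrite /xymax /xmin /ymin /side /=; lia.
Qed.

(** The grid and the holes both have [n] more upward than downward cells. *)
Lemma card_region : #|ups (region S)| = #|downs (region S)|.
Proof.
have split_grid (P : pred (unit_tri n)) : #|[set c in [set: unit_tri n] | P c]|
    = #|[set c in holes | P c]| + #|[set c in region S | P c]|.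
  rewrite -(cardsID holes); congr addn; apply: eq_card => c.
    by rewrite 3!inE andbC; congr andb; rewrite inE.
  by rewrite in_setD !in_set -mem_region.
have := card_grid; rewrite /ups /downs !split_grid.
by have := card_holes; rewrite /ups /downs; lia.
Qed.

(** The cover bound is applied to the neighbours of [X] together with the upward cells of the holes.
    Elements of [X] and downward cells of holes are full there, and the total side, at least [n],
    cancels the upward excess of the holes. *)
Lemma region_hall (X : {set unit_tri n}) :
  X \subset downs (region S) -> #|X| <= #|nbhd (radj (region S)) X|.
Proof.
move=> sX; set N := nbhd _ X; pose A := N :|: ups holes.
have upA : A \subset [set c | isup c].
  apply/subsetP=> u; rewrite in_setU inE => /orP[|/setIdP[] //].
  by case/nbhdP => d _ /andP[/adjP[]].
have [Ts cov le] := triangle_cover upA.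
have leA : #|A| <= #|N| + #|ups holes| by apply: leq_card_setU.
have leF : #|X| + #|downs holes| <= #|full A|.
  rewrite -[X in X <= _]subn0 -[X in _ - X](cards0 (unit_tri n)).
  have <- : X :&: downs holes = set0.
    apply/setP=> d; rewrite in_setI in_set0; apply/negbTE/negP => /andP[].
    by move/(subsetP sX)/setIdP => []; rewrite mem_region => /negP dh _ /setIdP[].
  rewrite -cardsU; apply: subset_leq_card; apply/subsetP=> d.
  rewrite in_setU => dXH; apply/fullP; split=> [|u du].
    by case/orP: dXH => [/(subsetP sX)|] /setIdP[].
  have [_ uu _ _ _] := adjP du; rewrite in_setU.
  have [uh|uh] := boolP (u \in holes); first by rewrite [u \in ups _]inE uh uu orbT.
  apply/orP; left; apply/nbhdP; exists d; last by rewrite /radj du mem_region.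
  case/orP: dXH => // /setIdP[/bigcupP[s sS ds] _]; case/bigcupP: uh.
  by exists s => //; apply: adj_cells du ds.
(* Each hole is compared with the cover; after exchanging sums, spread-outness applies at each
   [T]. *)
have leN : n <= \sum_(T <- Ts) side T.
  rewrite -[X in X <= _]hsum.
  apply: (@leq_trans (\sum_(s in S) \sum_(T <- Ts) cap_size s T)).
    apply: leq_sum => s sS; apply: side_le_cover => u /setIdP[us uu].
    apply: cov; rewrite in_setU [u \in ups _]inE uu andbT; apply/orP; right.
    by apply/bigcupP; exists s.
  by rewrite exchange_big /=; apply: leq_sum => T _; apply: hspread.
have arith (t f a k hu hd x : nat) : t + f <= a -> a <= k + hu ->
  x + hd <= f -> n <= t -> hu = hd + n -> x <= k by lia.
exact: arith le leA leF leN card_holes.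
Qed.

(** One hole containing both would contain [d]; two different holes would touch. *)
Lemma adj_holes d u v : d \notin holes -> adj d u -> adj d v -> u != v ->
  u \in holes -> v \notin holes.
Proof.
move=> dh du dv uv /bigcupP[s sS us]; apply/bigcupP => -[t tS vt].
have [st|st] := eqVneq s t.
  case/bigcupP: dh; exists s => //.
  by rewrite -st in vt; apply: adj2_cells du dv uv us vt.
exact: adj2_touch du dv us vt (hapart sS tS st).
Qed.

(** At least two of the three neighbours differ from [f d], and at most one of these lies in a
    hole. *)
Lemma region_degree f : {in downs (region S), forall d,
  exists2 u, radj (region S) d u & u != f d}.
Proof.
move=> d /setIdP[]; rewrite mem_region => dh dd.
have [//|//|u [du ux uy]] := @adj_ex _ d 0 0.
have [//|//|v [dv vx vy]] := @adj_ex _ d 1 0.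
have [//|//|w [dw wx wy]] := @adj_ex _ d 0 1.
have uv : u != v.
  by apply/eqP => e; clear -e ux vx; rewrite e in ux; lia.
have uw : u != w.
  by apply/eqP => e; clear -e uy wy; rewrite e in uy; lia.
have vw : v != w.
  by apply/eqP => e; clear -e vy wy; rewrite e in vy; lia.
have two p q : adj d p -> adj d q -> p != q -> p != f d -> q != f d ->
    exists2 z, radj (region S) d z & z != f d.
  move=> dp dq pq pf qf; have [ph|ph] := boolP (p \in holes).
    by exists q; rewrite // /radj dq mem_region (adj_holes dh dp dq pq).
  by exists p; rewrite // /radj dp mem_region.
have [uf|uf] := eqVneq u (f d).
  by apply: (two v w); rewrite // -uf eq_sym.
have [vf|vf] := eqVneq v (f d); last exact: (two u v).
by apply: (two u w); rewrite // -vf eq_sym.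
Qed.

(* A hole other than Delta has a side in the interior of Delta; the downward
   triangle across it touches the hole, so it lies in no hole. *)
Lemma region_downs_neq0 :
  S <> [set whole hn] -> downs (region S) != set0.
Proof.
move=> hneq.
have [s sS sW] : exists2 s, s \in S & s != whole hn.
  have [s /andP[sS sW]|no] := pickP (fun s => (s \in S) && (s != whole hn)).
    by exists s.
  have SW s : s \in S -> s = whole hn.
    by move=> sS; have := no s; rewrite sS /= => /eqP.
  have [S0|[s sS]] := set_0Vmem S; first by move: hsum hn; rewrite S0 big_set0; lia.
  case: hneq; apply/eqP; rewrite eqEsubset sub1set -{2}(SW s sS) sS andbT.
  by apply/subsetP=> t /SW->; apply: set11.
have [s0 sn] := uptriP s.
have notW : [|| 0 < xmin s, 0 < ymin s | xymax s < n].
  apply: contraR sW => h.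
  have [x y k] : [/\ xmin s = 0, ymin s = 0 & side s = n].
    by move: h sn; rewrite /xymax => h sn; split; lia.
  by apply/eqP/uptri_eq; rewrite ?x ?y ?k.
(* Another hole containing [d] would share the point [p] with [s]. *)
have touch d p : ~~ isup d -> d \notin cells s -> p \in vertices d ->
    in_tri s p -> downs (region S) != set0.
  move=> dd ds pd ps; apply/set0Pn; exists d; rewrite inE mem_region dd andbT.
  apply/bigcupP => -[t tS dt].
  have [ts|ts] := eqVneq s t; first by rewrite -ts (negbTE ds) in dt.
  have := hapart sS tS ts p; rewrite ps /=.
  by move: dt; rewrite inE => /allP/(_ p pd) ->.
have mk x y : x + y + 2 <= n -> exists d : unit_tri n, [/\ ~~ isup d, cx d = x, cy d = y
    & vertices d = [:: (x.+1, y); (x, y.+1); (x.+1, y.+1)]].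
  move=> /(@unit_tri_ex n false)[d [dd dx dy]]; exists d; split; rewrite ?dd //.
  by move: dd dx dy; rewrite /vertices /isup /cx /cy => -> -> ->.
(* The witness lies across the left, bottom or slanted side of [s], and [p] is a corner of [s]. *)
case/or3P: notW => [x0|y0|xy].
- have [|d [dd dx dy vd]] := mk (xmin s).-1 (ymin s).
    by move: sn; rewrite /xymax; lia.
  apply: (touch d (xmin s, ymin s) dd).
  + by rewrite mem_cells dx; lia.
  + by rewrite vd prednK // mem_head.
  + by rewrite /in_tri /xymax /=; lia.
- have [|d [dd dx dy vd]] := mk (xmin s) (ymin s).-1.
    by move: sn; rewrite /xymax; lia.
  apply: (touch d (xmin s, ymin s) dd).
  + by rewrite mem_cells dy; lia.
  + by rewrite vd prednK // !inE eqxx orbT.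
  + by rewrite /in_tri /xymax /=; lia.
- have [|d [dd dx dy vd]] := mk (xymax s - ymin s).-1 (ymin s).
    by move: s0 xy; rewrite /xymax; lia.
  apply: (touch d (xymax s - ymin s, ymin s) dd).
  + by rewrite mem_cells (negbTE dd) dx dy; move: s0; rewrite /xymax; lia.
  + by rewrite vd prednK ?mem_head //; move: s0; rewrite /xymax; lia.
  + by rewrite /in_tri /xymax /=; lia.
Qed.

End Holes.

Theorem mainTheorem1 (n : nat) (hn : 1 <= n) (S : {set uptri n})
  (hdisj : forall s t : uptri n,
     s \in S -> t \in S -> s != t -> interior_disjoint s t)
  (hsum : \sum_(s in S) side s = n)
  (hspread : spread_out S)
  (hneq : S <> [set whole hn])
  (hapart : forall s t : uptri n, s \in S -> t \in S -> s != t -> apart s t) :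
  2 <= #|tilings (region S)|.
Proof.
have D0 := region_downs_neq0 hsum hapart hneq.
(* Any cell serves as the default value for [hall]. *)
have /set0Pn[c _] := D0.
have [f mf] := hall c (region_hall hn hsum hspread hapart).
have cardR := card_region hn hsum hapart.
have [|||g mg [d dD gf]] := second_matching (E := ups (region S)) D0 _ mf.
- by rewrite cardR.
- by move=> e u /andP[/adjP[_ uu _ _ _] uR]; rewrite inE uR.
- exact: region_degree.
have fg : rhombi (region S) f != rhombi (region S) g.
  by apply: contra gf => /eqP/(rhombi_inj mf mg)/(_ d dD)->.
apply: (@leq_trans #|[set rhombi (region S) f; rhombi (region S) g]|).
  by rewrite cards2 fg.
apply: subset_leq_card; apply/subsetP=> P /set2P PE; rewrite inE.
by case: PE => ->; apply: matching_tiling.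
Qed.
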